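(* Fix real numbers $\alpha\le\beta$. Run the discrete-time totally asymmetric exclusion process starting from the state $x^*$. Then the number of particles located in the interval $[\alpha n,\beta n]$ at time $n$, divided by $n$, converges in probability as $n\to\infty$ to $h(\alpha)-h(\beta)$, where \[ h(u)=\begin{cases} -u & u<-\tfrac12,\\ \frac{1-u}{2}-\frac12\sqrt{\tfrac12-u^2} & -\tfrac12\le u\le \tfrac12,\\ 0 & u>\tfrac12.\end{cases}\]
   Context: States are sequences $x=(x_i)_{i\in\mathbb{Z}}\in\{0,1\}^{\mathbb{Z}}$; $x_i=1$ means a particle is at site $i$. The discrete-time totally asymmetric exclusion process evolves as follows: given the state at time $n$, for each $i$ with $x_i=1$ and $x_{i+1}=0$ toss an independent fair coin; on heads set $x'_i=0,x'_{i+1}=1$, on tails leave both unchanged; all other coordinates are unchanged. This gives the state at time $n+1$. The initial state $x^*$ has $x^*_i=1$ for $i\le 0$ and $x^*_i=0$ for $i>0$. *)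

(* Defs.v *)
From HB Require Import structures.
From mathcomp Require Export all_boot all_order all_algebra finmap.
From mathcomp Require Export all_classical all_reals all_analysis.

Set Implicit Arguments.
Unset Strict Implicit.
Unset Printing Implicit Defensive.

Export Order.TTheory GRing.Theory Num.Theory.
Export numFieldNormedType.Exports.

Local Open Scope classical_set_scope.
Local Open Scope ring_scope.

Definition mutually_independent (d d' : measure_display)
    (T : measurableType d) (T' : measurableType d') (R : realType)
    (P : probability T R) (I : choiceType) (X : I -> {RV P >-> T'}) : Prop :=
  forall (J : {fset I}) (A : I -> set T'),
    (forall i, measurable (A i)) ->
    P (\bigcap_(i in [set` J]) (X i @^-1` A i)) =
      (\prod_(i <- J) P (X i @^-1` A i))%E.

(* Only applied here to functions that depend on finitely many coins, so that
   the events below are measurable. *)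
Definition cvg_in_probability (d : measure_display) (T : measurableType d)
    (R : realType) (P : probability T R) (Y : nat -> T -> R) (c : R) : Prop :=
  forall eps : R, 0 < eps ->
    (fun n => P [set w | eps < `|Y n w - c|]) @ \oo --> 0%E.

Definition state := int -> bool.

Definition tasep_init : state := fun i => i <= 0.

(* [toss i] is the coin attached to the pair of sites (i, i + 1), [true] being
   heads; it is consulted only when x_i = 1 and x_(i+1) = 0. *)
Definition tasep_step (toss : int -> bool) (x : state) : state :=
  fun i =>
    if x i && ~~ x (i + 1) then ~~ toss i
    else if x (i - 1) && ~~ x i then toss (i - 1)
    else x i.

(* [coin (n, i)] is the coin available at site i for the transition from time n
   to time n + 1. *)
Fixpoint tasep (T : Type) (coin : nat * int -> T -> bool) (n : nat) (w : T)
    : state :=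
  if n is m.+1
  then tasep_step (fun i => coin (m, i) w) (tasep coin m w)
  else tasep_init.

Definition num_particles (R : realType) (x : state) (a b : R) : nat :=
  #|` fset_set [set i : int | a <= i%:~R <= b /\ x i] |.

Definition tasep_h (R : realType) (u : R) : R :=
  if u < - (1 / 2) then - u
  else if u <= 1 / 2 then (1 - u) / 2 - 1 / 2 * Num.sqrt (1 / 2 - u ^+ 2)
  else 0.

(* Main.v *)
Require Import Defs.
From mathcomp Require Import zify ring lra.

(* The height N(i), the number of particles at sites > i, evolves by
   N'(i) = min (N(i - 1), N(i + 1) + 1) where the coin is heads and N'(i) = N(i)
   where it is tails. This map is linear over the min-plus semiring, and every
   height function h is the minimum over j of the translated step profiles
   h(j) + max (0, j - i). Hence, if L_n(j) denotes the height at site 0 and time n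
   started from max (0, j - .), the height started from h is min_j (h(j) + L_n(j)).

   Choose h random, with occupation numbers forming the stationary Markov chain of
   density rho; a Burke-type property shows that it is stationary and that its
   height grows at rate f(rho) = (1 - sqrt (1 - 2 rho (1 - rho))) / 2. Taking
   expectations in H_n <= h(j) + L_n(j) gives E L_n(j) >= n f(rho) + rho j for every
   rho, i.e. the lower bound by the Legendre transform of f. Conversely, for the rho
   dual to u, this lower bound is strict away from j = - u n, so if E L_n(- u n) were
   too large then, after discarding fluctuations, H_n would exceed n f(rho).
   Fluctuations are controlled by Var L_n(j) <= n: one time step changes the
   conditional mean of the height by at most 1. *)

Set Implicit Arguments.
Unset Strict Implicit.
Unset Printing Implicit Defensive.

Local Open Scope classical_set_scope.
Local Open Scope ring_scope.

(** * Finite expectations *)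

Section Expectation.
Variable R : realType.

(** Positive, normalized linear functionals stand in for integrals: all laws used for the estimates
    have finite support, so no measurability or integrability conditions arise. *)
Definition is_expectation (A : Type) (E : (A -> R) -> R) : Prop :=
  [/\ forall c, E (fun=> c) = c,
      forall f g, E (fun a => f a + g a) = E f + E g,
      forall c f, E (fun a => c * f a) = c * E f &
      forall f g, (forall a, f a <= g a) -> E f <= E g].

Section Theory.
Variables (A : Type) (E : (A -> R) -> R).
Hypothesis EE : is_expectation E.

Lemma meanC c : E (fun=> c) = c. Proof. by case: EE. Qed.
Lemma meanD f g : E (fun a => f a + g a) = E f + E g. Proof. by case: EE. Qed.
Lemma meanZ c f : E (fun a => c * f a) = c * E f. Proof. by case: EE. Qed.
Lemma ler_mean f g : (forall a, f a <= g a) -> E f <= E g.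
Proof. by case: EE => _ _ _; apply. Qed.
Lemma eq_mean f g : f =1 g -> E f = E g.
Proof. by move=> /funext->. Qed.
Lemma meanN f : E (fun a => - f a) = - E f.
Proof. by rewrite -mulN1r -meanZ; apply: eq_mean => a; rewrite mulN1r. Qed.
Lemma meanB f g : E (fun a => f a - g a) = E f - E g.
Proof. by rewrite meanD meanN. Qed.
Lemma mean_sum (I : Type) (r : seq I) (f : I -> A -> R) :
  E (fun a => \sum_(i <- r) f i a) = \sum_(i <- r) E (f i).
Proof.
elim: r => [|i r IH].
  by rewrite big_nil -[RHS](meanC 0); apply: eq_mean => a; rewrite big_nil.
by rewrite big_cons -IH -meanD; apply: eq_mean => a; rewrite big_cons.
Qed.

Definition variance (f : A -> R) := E (fun a => (f a - E f) ^+ 2).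

Lemma mean_sqrB f c :
  E (fun a => (f a - c) ^+ 2) = variance f + (E f - c) ^+ 2.
Proof.
have -> : (fun a => (f a - c) ^+ 2) =
  (fun a => (f a - E f) ^+ 2 + ((E f - c) ^+ 2 + 2 * (E f - c) * (f a - E f))).
  by apply/funext => a; ring.
by rewrite !meanD meanC meanZ meanB meanC subrr mulr0 addr0.
Qed.

(** Pointwise [c * x <= c ^+ 2 + x ^+ 2] for [x = |f - E f|]; dividing by [c] leaves a free
    parameter to be scaled with time later. *)
Lemma mean_normB_le f v c : variance f <= v -> 0 < c ->
  E (fun a => `|f a - E f|) <= c + v / c.
Proof.
move=> fv c0; have c0' : 0 <= c^-1 by rewrite invr_ge0 ltW.
apply: (@le_trans _ _ (E (fun a => c + c^-1 * (f a - E f) ^+ 2))).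
  apply: ler_mean => a; rewrite -real_normK ?num_real//.
  set x := `|_|; have x0 : 0 <= x by apply: normr_ge0.
  rewrite -(ler_pM2l c0) mulrDr mulrA divff ?gt_eqF// mul1r.
  by have := sqr_ge0 (x - c); have := mulr_ge0 x0 (ltW c0); nra.
by rewrite meanD meanC meanZ lerD2l mulrC ler_wpM2r.
Qed.

Lemma chebyshev_mean f c eps : 0 < eps ->
  E (fun a => (eps < `|f a - c|)%R%:R) <= (variance f + (E f - c) ^+ 2) / eps ^+ 2.
Proof.
move=> e0; rewrite ler_pdivlMr ?exprn_gt0// mulrC -meanZ -mean_sqrB.
apply: ler_mean => a; case: ltP => [lt_e|_]; last by rewrite mulr0 sqr_ge0.
by rewrite mulr1 -[leRHS]real_normK ?num_real// lerXn2r ?nnegrE ?(ltW e0)// ltW.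
Qed.
End Theory.

Lemma is_expectation_comp (A B C : Type) (E : (A -> R) -> R)
    (F : A -> (B -> R) -> R) (g : A -> B -> C) :
  is_expectation E -> (forall a, is_expectation (F a)) ->
  is_expectation (fun f => E (fun a => F a (fun b => f (g a b)))).
Proof.
move=> EE FE; split.
- move=> c; rewrite -[RHS](meanC EE); apply: eq_mean => a.
  exact: (meanC (FE a)).
- move=> f f'; rewrite -(meanD EE); apply: eq_mean => a.
  exact: (meanD (FE a)).
- move=> c f; rewrite -(meanZ EE); apply: eq_mean => a.
  exact: (meanZ (FE a)).
- move=> f f' ff'; apply: (ler_mean EE) => a.
  by apply: (ler_mean (FE a)) => b.
Qed.

Lemma is_expectation_dirac (A : Type) (a : A) :
  is_expectation (fun f : A -> R => f a).
Proof. by split. Qed.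

Definition mix (A : Type) (a : R) (E F : (A -> R) -> R) f := a * E f + (1 - a) * F f.

Lemma is_expectation_mix (A : Type) (a : R) (E F : (A -> R) -> R) :
  0 <= a <= 1 -> is_expectation E -> is_expectation F ->
  is_expectation (mix a E F).
Proof.
move=> /andP[a0 a1] EE FE; rewrite /mix; split.
- by move=> c; rewrite (meanC EE) (meanC FE); ring.
- by move=> f f'; rewrite (meanD EE) (meanD FE); ring.
- by move=> c f; rewrite (meanZ EE) (meanZ FE); ring.
- move=> f f' ff'; have := ler_mean EE ff'; have := ler_mean FE ff'.
  by move=> ? ?; rewrite lerD// ler_wpM2l// subr_ge0.
Qed.

(** The law of [n] successive symbols of a two-state Markov chain: [y] is the symbol preceding the
    word, and [a y] the probability that [true] follows [y]. *)
Fixpoint chain (a : bool -> R) n y (f : seq bool -> R) : R :=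
  if n is m.+1
  then mix (a y) (fun g => chain a m true (fun s => g (true :: s)))
                 (fun g => chain a m false (fun s => g (false :: s))) f
  else f [::].

Lemma chainS a n y f : chain a n.+1 y f =
  a y * chain a n true (fun s => f (true :: s)) +
  (1 - a y) * chain a n false (fun s => f (false :: s)).
Proof. by []. Qed.

Section Chain.
Variable a : bool -> R.
Hypothesis a01 : forall y, 0 <= a y <= 1.

Lemma is_expectation_chain n y : is_expectation (chain a n y).
Proof.
elim: n y => [|n IH] y /=; first exact: is_expectation_dirac.
apply: is_expectation_mix => //.
- have := @is_expectation_comp unit _ _ _ (fun=> chain a n true)
    (fun _ => cons true) (is_expectation_dirac tt) (fun _ => IH true).
  exact.
- have := @is_expectation_comp unit _ _ _ (fun=> chain a n false)
    (fun _ => cons false) (is_expectation_dirac tt) (fun _ => IH false).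
  exact.
Qed.

Lemma eq_chain n y f g : (forall s, size s = n -> f s = g s) ->
  chain a n y f = chain a n y g.
Proof.
elim: n y f g => [|n IH] y f g fg /=; first exact: fg.
by congr (_ * _ + _ * _); apply: IH => s sn; apply: fg; rewrite /= sn.
Qed.

Lemma chain_cat m n y f : chain a (m + n) y f =
  chain a m y (fun s => chain a n (last y s) (fun s' => f (s ++ s'))).
Proof. by elim: m y f => [|m IH] y f //=; rewrite /mix !IH. Qed.

Lemma chain_take m n y f : (m <= n)%N ->
  chain a n y (fun s => f (take m s)) = chain a m y f.
Proof.
move=> mn; rewrite -(subnKC mn) chain_cat; apply: eq_chain => s sm.
rewrite -[RHS](meanC (is_expectation_chain (n - m) (last y s))).
by apply: eq_mean => s'; rewrite -sm take_size_cat.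
Qed.

End Chain.

Definition coins n := chain (fun=> 1 / 2) n true.

Lemma coin01 (y : bool) : 0 <= (1 / 2 : R) <= 1.
Proof. by lra. Qed.

Lemma is_expectation_coins n : is_expectation (coins n).
Proof. exact: is_expectation_chain coin01 _ _. Qed.

Lemma coins_start n y f : chain (fun=> 1 / 2) n y f = coins n f.
Proof. by case: n. Qed.

Lemma coinsS n f : coins n.+1 f =
  (coins n (fun s => f (true :: s)) + coins n (fun s => f (false :: s))) / 2.
Proof. by rewrite /coins /= /mix !coins_start; field. Qed.

Lemma coins_cat m n f :
  coins (m + n) f = coins m (fun s => coins n (fun s' => f (s ++ s'))).
Proof.
by rewrite /coins chain_cat; apply: eq_mean => s; rewrite coins_start.
Qed.

Lemma coins_drop m n f : coins (m + n) (fun s => f (drop m s)) = coins n f.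
Proof.
rewrite coins_cat -[RHS](meanC (is_expectation_coins m)).
by apply: eq_chain => s sm; apply: eq_mean => s'; rewrite -sm drop_size_cat.
Qed.

Lemma coins_take m n f : (m <= n)%N ->
  coins n (fun s => f (take m s)) = coins m f.
Proof. exact: (chain_take coin01). Qed.

End Expectation.

(** * Height functions *)

Definition hstep (t : int -> bool) (h : int -> int) : int -> int :=
  fun i => if t i then Num.min (h (i - 1)) (h (i + 1) + 1) else h i.

Definition evol (ts : seq (int -> bool)) (h : int -> int) : int -> int :=
  foldl (fun g t => hstep t g) h ts.

Definition height (h : int -> int) := forall i, h i <= h (i - 1) <= h i + 1.

Definition cone (j i : int) : int := Num.max 0 (j - i).

Lemma height_cone j : height (cone j).
Proof. by move=> i; rewrite /cone; lia. Qed.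

Lemma hstep_bounds t h i : height h -> h i <= hstep t h i <= h i + 1.
Proof.
move=> hh; rewrite /hstep; have := hh i; have := hh (i + 1).
by rewrite addrK; case: (t i); lia.
Qed.

Lemma height_hstep t h : height h -> height (hstep t h).
Proof.
move=> hh i; rewrite /hstep subrK.
have := hh i; have := hh (i + 1); have := hh (i - 1).
by rewrite addrK; case: (t i); case: (t (i - 1)); lia.
Qed.

Lemma height_evol ts h : height h -> height (evol ts h).
Proof. by elim: ts h => //= t ts IH h hh; exact/IH/height_hstep. Qed.

Lemma hstepD t h c i : hstep t (fun z => c + h z) i = c + hstep t h i.
Proof. by rewrite /hstep; case: (t i); lia. Qed.

Lemma evolD ts h c i : evol ts (fun z => c + h z) i = c + evol ts h i.
Proof.
elim: ts h => //= t ts IH h; rewrite -IH.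
by congr (evol ts _ i); apply/funext => z; exact: hstepD.
Qed.

Lemma le_hstep t h g : (forall i, h i <= g i) ->
  forall i, hstep t h i <= hstep t g i.
Proof.
move=> hg i; rewrite /hstep; have := (hg (i - 1), hg (i + 1), hg i).
by case=> -[]; case: (t i); lia.
Qed.

Lemma le_evol ts h g : (forall i, h i <= g i) ->
  forall i, evol ts h i <= evol ts g i.
Proof. by elim: ts h g => //= t ts IH h g hg; exact/IH/le_hstep. Qed.

Lemma evol_bounds ts h i : height h -> h i <= evol ts h i <= h i + (size ts)%:Z.
Proof.
elim: ts h => /= [|t ts IH] h hh; first by lia.
by have := IH _ (height_hstep t hh); have := hstep_bounds t i hh; lia.
Qed.

Lemma height_lipschitz h i (k : nat) : height h ->
  h (i + k%:Z) <= h i <= h (i + k%:Z) + k%:Z.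
Proof.
move=> hh; elim: k => [|k IH]; first by rewrite addr0; lia.
have := hh (i + k.+1%:Z); have -> : i + k.+1%:Z - 1 = i + k%:Z by lia.
by lia.
Qed.

(** A height function is nonincreasing with slopes at most 1 in absolute value, so [h j + cone j] is
    the largest one taking the value [h j] at [j]. *)
Lemma le_cone h j i : height h -> h i <= h j + cone j i.
Proof.
move=> hh; rewrite /cone; case: (leP j i) => ji.
  have := height_lipschitz j `|i - j|%N hh.
  by rewrite (_ : j + `|i - j|%N%:Z = i); lia.
have := height_lipschitz i `|j - i|%N hh.
by rewrite (_ : i + `|j - i|%N%:Z = j); lia.
Qed.

Lemma evol_le_cone ts h j i : height h ->
  evol ts h i <= h j + evol ts (cone j) i.
Proof.
by move=> hh; rewrite -evolD; apply: le_evol => z; exact: le_cone.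
Qed.

(* Together with evol_le_cone: the evolution is linear over the min-plus
   semiring, hence is a minimum over evolutions of cones. *)
Lemma evol_cone_le ts h (i : int) : height h ->
  exists2 j, `|j - i| <= (size ts)%:Z & h j + evol ts (cone j) i <= evol ts h i.
Proof.
elim: ts h => /= [|t ts IH] h hh.
  by exists i; rewrite /cone; lia.
have [j ji le_j] := IH _ (height_hstep t hh).
(* One step suffices: by [evol_le_cone], evolving [hstep t (cone k)] further stays below its value
   at [j] plus the evolution of [cone j]. *)
suff [k kj le_k] : exists2 k, `|k - j| <= 1 & h k + hstep t (cone k) j <= hstep t h j.
  exists k; first by lia.
  have := evol_le_cone ts j i (height_hstep t (height_cone k)).
  by lia.
rewrite /hstep; case: (t j); last by exists j; rewrite /cone; lia.
case: (leP (h (j - 1)) (h (j + 1) + 1)) => _.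
  by exists (j - 1); rewrite /cone; lia.
by exists (j + 1); rewrite /cone; lia.
Qed.

Lemma evol_shift ts h (i z : int) :
  evol [seq (fun k : int => t (k + i)) | t <- ts] (fun k => h (k + i)) z =
  evol ts h (z + i).
Proof.
elim: ts h => //= t ts IH h; rewrite -IH; congr (evol _ _ z).
apply/funext => k; rewrite /hstep.
by have [-> ->] : k - 1 + i = k + i - 1 /\ k + 1 + i = k + i + 1 by lia.
Qed.

(** Finite speed of propagation: each step reads only adjacent sites, so only the backward light
    cone of [i] matters. *)
Lemma eq_evol_local (ts ts' : seq (int -> bool)) (h h' : int -> int) (i : int) :
  size ts = size ts' ->
  (forall k (z : int), `|z - i| <= (size ts)%:Z ->
     nth xpred0 ts k z = nth xpred0 ts' k z) ->
  (forall z : int, `|z - i| <= (size ts)%:Z -> h z = h' z) ->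
  evol ts h i = evol ts' h' i.
Proof.
elim: ts ts' h h' => [|t ts IH] [|t' ts'] //= h h'.
  by move=> _ _ hh'; apply: hh'; lia.
move=> [sts] tt hh'; apply: IH => // [k z zi|z zi].
  by apply: (tt k.+1); lia.
rewrite /hstep; have -> : t z = t' z by apply: (tt 0%N); lia.
by case: (t' z); rewrite !hh'//; lia.
Qed.

Definition occ (h : int -> int) : state := fun i => h (i - 1) == h i + 1.

(** The minimum in [hstep] exceeds [h i] exactly when [i] is occupied and [i + 1] is empty, so
    raising the height is the same as letting a particle jump from [i] to [i + 1]. *)
Lemma occ_hstep t h : height h -> occ (hstep t h) = tasep_step t (occ h).
Proof.
move=> hh; apply/funext => i; rewrite /occ /tasep_step /hstep subrK addrK.
have := (hh i, hh (i + 1), hh (i - 1)); rewrite addrK => -[[]].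
case: (t i); case: (t (i - 1)); do ?case: ifPn; rewrite ?addrK ?subrK; try lia.
Qed.

Lemma hstep_incr t h i : height h ->
  hstep t h i - h i = ([&& occ h i, ~~ occ h (i + 1) & t i])%:R.
Proof.
move=> hh; rewrite /occ /hstep addrK; have := (hh i, hh (i + 1)).
by rewrite addrK => -[]; case: (t i); rewrite ?andbT ?andbF; lia.
Qed.

Lemma occ_cone0 : occ (cone 0) = tasep_init.
Proof. by apply/funext => i; rewrite /occ /tasep_init /cone; lia. Qed.

Lemma tasep_evol (T : Type) (coin : nat * int -> T -> bool) n w :
  tasep coin n w =
  occ (evol [seq (fun i => coin (k, i) w) | k <- iota 0 n] (cone 0)).
Proof.
elim: n => [|n IH]; first by rewrite /= occ_cone0.
rewrite -addn1 iotaD map_cat addn1 /evol foldl_cat /= add0n occ_hstep -?IH//.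
exact/height_evol/height_cone.
Qed.

(** * Tosses and the stationary chain *)

Section Rows.
Variable R : realType.

(** Law of total variance: the conditional variance is at most [v], and conditional means confined
    to an interval of length 1 differ from the overall mean by at most 1. *)
Lemma variance_comp_le (A B C : Type) (E : (A -> R) -> R)
    (F : A -> (B -> R) -> R) (g : A -> B -> C) (X : C -> R) (v l : R) :
  is_expectation E -> (forall a, is_expectation (F a)) ->
  (forall a, variance (F a) (fun b => X (g a b)) <= v) ->
  (forall a, l <= F a (fun b => X (g a b)) <= l + 1) ->
  variance (fun f => E (fun a => F a (fun b => f (g a b)))) X <= v + 1.
Proof.
move=> EE FE Fv Fl; pose m := E (fun a => F a (fun b => X (g a b))); rewrite /variance -/m.
have lm : l <= m <= l + 1.
  have le_lm := ler_mean EE (fun a => proj1 (andP (Fl a))).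
  have ge_lm := ler_mean EE (fun a => proj2 (andP (Fl a))).
  by move: le_lm ge_lm; rewrite !(meanC EE) => lm ml; apply/andP; split.
rewrite -[leRHS](meanC EE); apply: (ler_mean EE) => a.
rewrite (mean_sqrB (FE a)) lerD//.
by have := Fl a; move: (F a _) => x; nra.
Qed.

(* A toss on the window [- M, M]; sites outside of it get junk values. *)
Definition dec (M : nat) (s : seq bool) : int -> bool :=
  fun z => nth false s `|(z + M%:Z)%R|%N.

Fixpoint rows (M k : nat) (s : seq bool) : seq (int -> bool) :=
  if k is k'.+1
  then dec M (take M.*2.+1 s) :: rows M k' (drop M.*2.+1 s) else [::].

Lemma size_rows M k s : size (rows M k s) = k.
Proof. by elim: k s => //= k IH s; rewrite IH. Qed.

Definition tosses M k (f : seq (int -> bool) -> R) : R :=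
  coins (k * M.*2.+1) (fun s => f (rows M k s)).

Lemma is_expectation_tosses M k : is_expectation (tosses M k).
Proof.
exact: (@is_expectation_comp _ unit _ _ _
  (fun=> coins (k * M.*2.+1)) (fun _ => rows M k)
  (is_expectation_dirac _ tt) (fun=> is_expectation_coins _ _)).
Qed.

Lemma tossesS M k f : tosses M k.+1 f =
  coins M.*2.+1 (fun s => tosses M k (fun ts => f (dec M s :: ts))).
Proof.
rewrite /tosses mulSn coins_cat; apply: eq_chain => s sM.
by apply: eq_mean => s' /=; rewrite -sM take_size_cat// drop_size_cat.
Qed.

(** Condition on the first row of coins. It raises heights by 0 or 1, and the later evolution is
    monotone and commutes with constants, so the conditional mean varies within an interval of
    length 1. *)
Lemma variance_evol M k h z : height h ->
  variance (tosses M k) (fun ts => (evol ts h z)%:~R) <= k%:R.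
Proof.
elim: k h => [|k IH] h hh.
  by rewrite /variance /tosses /coins /= subrr expr0n.
pose T := fun f => coins M.*2.+1 (fun s => tosses M k (fun ts => f (dec M s :: ts))).
have -> : tosses M k.+1 = T by apply/funext => f; rewrite tossesS.
rewrite -natr1.
apply: (@variance_comp_le _ _ _ _ (fun=> tosses M k) (fun s => cons (dec M s))
  (fun ts => (evol ts h z)%:~R) _ (tosses M k (fun ts => (evol ts h z)%:~R))).
- exact: is_expectation_coins.
- by move=> s; exact: is_expectation_tosses.
- by move=> s /=; exact/IH/height_hstep.
move=> s /=; have tE := is_expectation_tosses M k.
have hs i := hstep_bounds (dec M s) i hh.
apply/andP; split.
  apply: (ler_mean tE) => ts; rewrite ler_int; apply: le_evol => i.
  by case/andP: (hs i).
rewrite -[X in _ + X](meanC tE) -(meanD tE); apply: (ler_mean tE) => ts.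
rewrite -[X in _ + X]/(1%:~R) -intrD ler_int addrC -evolD; apply: le_evol => i.
by rewrite addrC; case/andP: (hs i).
Qed.

End Rows.

(* [scan x c xs ts] is the updated state from the current site on, where [x] is the
   occupation of that site and [c] tells whether a particle jumps onto it. *)
Fixpoint scan (x c : bool) (xs ts : seq bool) : seq bool :=
  match xs, ts with
  | x' :: xs', t :: ts' =>
    let c' := [&& x, ~~ x' & t] in ((x && ~~ c') || c) :: scan x' c' xs' ts'
  | _, _ => [::]
  end.

(** Only interior sites are updated: the new states of the two end sites depend on neighbours
    outside the word. *)
Definition wstep (xs ts : seq bool) : seq bool :=
  match xs, ts with
  | x0 :: x1 :: xs', t :: ts' => scan x1 [&& x0, ~~ x1 & t] xs' ts'
  | _, _ => [::]
  end.

(** * Invariance of the stationary chain under one parallel step *)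

Section Stationary.
Variables (R : realType) (rho y : R).
Hypotheses (rho_gt0 : 0 < rho) (rho_lt1 : rho < 1).
Hypotheses (y_ge0 : 0 <= y) (y_le : y <= rho) (y_le' : y <= 1 - rho).
Hypothesis y_root : y ^+ 2 - 2 * y + 2 * rho * (1 - rho) = 0.

(* The stationary chain has density rho and P(x_i = 1, x_(i+1) = 0) = y. *)
Let p10 := y / rho.
Let p01 := y / (1 - rho).
Definition up (b : bool) : R := if b then 1 - p10 else p01.

Let rhoE : p10 * rho = y. Proof. by rewrite /p10 divfK ?gt_eqF. Qed.
Let rho'E : p01 * (1 - rho) = y.
Proof. by rewrite /p01 divfK// gt_eqF// subr_gt0. Qed.

(** In terms of pair probabilities, [y_root] reads P(10) P(01) = 2 P(11) P(00), with P(10) = P(01) =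
    [y], P(11) = [rho - y] and P(00) = [1 - rho - y]. *)
Let p_rel : p10 * p01 = 2 * (1 - p10) * (1 - p01).
Proof.
apply: (mulfI (_ : rho * (1 - rho) != 0)).
  by rewrite mulf_neq0 ?gt_eqF// subr_gt0.
have -> : rho * (1 - rho) * (p10 * p01) = y * y by rewrite -{1}rhoE -rho'E; ring.
have -> : rho * (1 - rho) * (2 * (1 - p10) * (1 - p01)) =
  2 * (rho - p10 * rho) * ((1 - rho) - p01 * (1 - rho)) by ring.
by rewrite rhoE rho'E; have := y_root; lra.
Qed.

Lemma up01 b : 0 <= up b <= 1.
Proof.
have r' : 0 < 1 - rho by rewrite subr_gt0.
rewrite /up /p10 /p01; case: b.
  by rewrite subr_ge0 ler_pdivrMr// mul1r y_le gerBl divr_ge0// ltW.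
by rewrite divr_ge0 ?(ltW r')//= ler_pdivrMr// mul1r.
Qed.

(** Adjacent sites are negatively correlated: by [p_rel] the gap is [- (p10 * p01 / 2)]. This bounds
    the influence of one site on later particle counts. *)
Lemma up_gap : -1 <= up true - up false <= 0.
Proof.
have -> : up true - up false = - (p10 * p01 / 2).
  by rewrite /up; have := p_rel; lra.
by have := up01 true; have := up01 false; rewrite /up; nra.
Qed.

Let p01_neq : 2 - p01 != 0.
Proof. by have := up01 false; rewrite /up; apply: contraTneq; lra. Qed.

Let p10E : p10 = 2 * (1 - p01) / (2 - p01).
Proof. by apply: (mulIf p01_neq); rewrite divfK//; have := p_rel; lra. Qed.

Let W x c L f : R :=
  chain up L x (fun xs => coins L (fun ts => f (scan x c xs ts))).

Let WS x c L f : W x c L.+1 f =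
  up x * W true false L (fun s => f ((x || c) :: s)) +
  (1 - up x) * (W false x L (fun s => f (c :: s)) +
                W false false L (fun s => f ((x || c) :: s))) / 2.
Proof.
have cE n b := is_expectation_chain up01 n b.
rewrite /W /= /mix; congr (_ * _ + _).
  apply: eq_mean => xs; rewrite coinsS /=.
  by rewrite !andbF /= andbT; field.
rewrite -mulrA; congr (_ * _).
rewrite -meanD//= mulrC -meanZ//; apply: eq_mean => xs; rewrite coinsS /= mulrC.
by rewrite !andbT andbF /= andbT andbN.
Qed.

(* Reverse Burke property: given the output sites so far, the hidden pair
   (current input site, particle arriving there) depends only on the last
   output site [b]; the weights below are its conditional law. *)
Let scan_chain b L f :
  chain up L b f =
  (if b then 1 else 1 - p01 / 2) *
    ((1 - p01) * W false false L f + p01 * W true false L f) +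
  (if b then 0 else p01 / 2) * W false true L f.
Proof.
elim: L b f => [|L IH] b f.
  by rewrite /W /coins /=; case: b; field.
rewrite !WS /= /mix !IH /=.
set w00 := W false false L _; set w10 := W true false L _.
set w01 := W false true L _; set v00 := W false false L _.
set v10 := W true false L _; set v01 := W false true L _.
by case: b; rewrite /= p10E; field.
Qed.

Definition stationary_mean L f : R := rho * chain up L true f + (1 - rho) * chain up L false f.

Lemma is_expectation_stat L : is_expectation (stationary_mean L).
Proof.
by apply: is_expectation_mix; rewrite ?ltW//; exact: is_expectation_chain up01 _ _.
Qed.

(** The density is preserved along the chain since [p10 * rho] and [p01 * (1 - rho)] both equal [y];
    the first symbol thus has the law of the symbol preceding the word. *)
Lemma stat_cons L f : stationary_mean L.+1 f =
  rho * chain up L true (fun s => f (true :: s)) +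
  (1 - rho) * chain up L false (fun s => f (false :: s)).
Proof.
rewrite /stationary_mean /= /mix /=; set a := chain _ _ _ _; set b := chain _ _ _ _.
have <- : (rho - p10 * rho + p01 * (1 - rho)) * a +
   (p10 * rho + (1 - rho) - p01 * (1 - rho)) * b = rho * a + (1 - rho) * b.
  by rewrite rhoE rho'E; ring.
by ring.
Qed.

Lemma stat_behead L f : stationary_mean L.+1 (fun s => f (behead s)) = stationary_mean L f.
Proof. by rewrite stat_cons. Qed.

Lemma stat_drop k L f : stationary_mean (k + L) (fun s => f (drop k s)) = stationary_mean L f.
Proof.
elim: k => [|k IH]; first by congr stationary_mean; apply/funext => s; rewrite drop0.
rewrite -IH -(stat_behead (k + L)); apply: eq_mean => -[|b s] //=.
Qed.

Lemma stat_take k L f : (k <= L)%N ->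
  stationary_mean L (fun s => f (take k s)) = stationary_mean k f.
Proof. by move=> kL; rewrite /stationary_mean !(chain_take up01). Qed.

(** Averaging over the two leftmost input sites and the first coin gives a mixture of the [W x c];
    [scan_chain] writes the right-hand side as such a mixture too, and the weights agree. *)
Lemma stat_wstep L f :
  stationary_mean L.+2 (fun xs => coins L.+1 (fun ts => f (wstep xs ts))) = stationary_mean L f.
Proof.
have inner x0 x1 :
    chain up L x1 (fun xs => coins L.+1 (fun ts => f (wstep [:: x0, x1 & xs] ts)))
    = (W x1 (x0 && ~~ x1) L f + W x1 false L f) / 2.
  have cE := is_expectation_chain up01 L x1.
  rewrite /W -(meanD cE) mulrC -(meanZ cE); apply: eq_mean => xs.
  by rewrite coinsS /= andbT !andbF mulrC.
rewrite stat_cons !chainS !inner /stationary_mean !scan_chain /= p10E.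
have p01_sqr : 2 - p01 ^+ 2 != 0.
  by have := up01 false; rewrite /up; apply: contraTneq; nra.
(* Solving the balance [p10 * rho = p01 * (1 - rho)] for [rho] turns the comparison of weights into
   a rational identity in [p01] alone. *)
have rhoF : rho = p01 * (2 - p01) / (2 - p01 ^+ 2).
  apply: (mulIf p01_sqr); rewrite divfK//.
  have : (2 - p01) * (p10 * rho) = (2 - p01) * (p01 * (1 - rho)).
    by rewrite rhoE rho'E.
  have -> : (2 - p01) * (p10 * rho) = (2 - p01) * p10 * rho by ring.
  by rewrite p10E [_ * (_ / _)]mulrC divfK//; lra.
by rewrite rhoF; field; rewrite p01_neq p01_sqr.
Qed.

Lemma stat_jump k r :
  stationary_mean (k + r.+2) (fun s => (nth false s k && ~~ nth false s k.+1)%:R) = y.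
Proof.
pose f s : R := (nth false s 0 && ~~ nth false s 1)%:R.
rewrite -(@eq_mean _ _ _ (fun s => f (drop k s))); last first.
  by move=> s; rewrite /f !nth_drop addn0 addn1.
rewrite stat_drop stat_cons /= /mix /f /=.
have up_ex b := is_expectation_chain up01 r b.
by rewrite !meanC//= -rhoE; ring.
Qed.

End Stationary.

(** * Finite windows of configurations and heights *)

Definition word (x : int -> bool) (a : int) (L : nat) : seq bool :=
  mkseq (fun j => x (a + j%:Z)) L.

Lemma wordS x a L : word x a L.+1 = x a :: word x (a + 1) L.
Proof.
rewrite /word /mkseq /= addr0; congr (_ :: _).
rewrite -[iota 1 L]/(iota (1 + 0) L) iotaDl -map_comp; apply: eq_map => j /=.
by rewrite PoszD addrA.
Qed.

(** The carry of [scan] is the jump onto the current site, so a single left-to-right pass performs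
    the parallel update. *)
Lemma scan_word t x i L :
  scan (x i) [&& x (i - 1), ~~ x i & t (i - 1)] (word x (i + 1) L) (word t i L) =
  word (tasep_step t x) i L.
Proof.
elim: L i => [|L IH] i //; rewrite !wordS /=; congr (_ :: _); last first.
  by have := IH (i + 1); rewrite !addrK.
rewrite /tasep_step.
by case: (x i) (x (i - 1)) (x (i + 1)) (t i) (t (i - 1)) => [] [] [] [] [].
Qed.

Lemma wstep_word t x a L :
  wstep (word x a L.+2) (word t a L.+1) = word (tasep_step t x) (a + 1) L.
Proof. by rewrite -scan_word !wordS /= addrK. Qed.

Lemma word_dec M k s : (k <= M)%N -> size s = M.*2.+1 ->
  word (dec M s) (- k%:Z) k.*2.+1 = take k.*2.+1 (drop (M - k) s).
Proof.
move=> kM sM; apply: (@eq_from_nth _ false).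
  by rewrite size_mkseq size_take size_drop sM; case: ltnP; lia.
move=> i; rewrite size_mkseq => ik.
rewrite nth_mkseq// nth_take// nth_drop /dec; congr nth; lia.
Qed.

(* The height function vanishing at [- M] whose occupation numbers at the sites
   1 - M, ..., M are given by [w]. *)
Definition hinit (M : nat) (w : seq bool) : int -> int :=
  fun j => - (count id (take `|(Num.max 0 (j + M%:Z))%R|%N w))%:Z.

Lemma hinitS M w (j : int) : 0 <= j + M%:Z ->
  hinit M w j = hinit M w (j + 1) + (nth false w `|(j + M%:Z)%R|%N)%:Z.
Proof.
move=> j0; rewrite /hinit.
have -> : Num.max 0 (j + 1 + M%:Z) = `|(j + M%:Z)%R|%N.+1%:Z by lia.
have -> : Num.max 0 (j + M%:Z) = `|(j + M%:Z)%R|%N%:Z by lia.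
rewrite !absz_nat; set k := `|_|%N.
have [kw|wk] := ltnP k (size w); last first.
  by rewrite nth_default// !take_oversize//; lia.
by rewrite (take_nth false kw) -cats1 count_cat /=; lia.
Qed.

Lemma height_hinit M w : height (hinit M w).
Proof.
move=> i; have [i0|i0] := leP 0 (i - 1 + M%:Z).
  by have := hinitS w i0; rewrite subrK; case: nth; lia.
rewrite /hinit; have -> : Num.max 0 (i - 1 + M%:Z) = 0 by lia.
have -> : Num.max 0 (i + M%:Z) = 0 by lia.
by rewrite take0; lia.
Qed.

Lemma word_hinit M w : size w = M.*2 ->
  word (occ (hinit M w)) (1 - M%:Z) M.*2 = w.
Proof.
move=> wM; apply: (@eq_from_nth _ false); first by rewrite size_mkseq wM.
move=> i; rewrite size_mkseq => iM; rewrite nth_mkseq// /occ.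
have i0 : 0 <= 1 - M%:Z + i%:Z - 1 + M%:Z by lia.
rewrite (hinitS w i0) subrK.
have -> : `|(1 - M%:Z + i%:Z - 1 + M%:Z)%R|%N = i by lia.
by rewrite (inj_eq (addrI _)); case: nth.
Qed.

(** * Mean growth and fluctuations in the stationary regime *)

Section Growth.
Variable R : realType.

Lemma coins_nth n k : (k < n)%N ->
  coins n (fun s => (nth false s k)%:R) = 1 / 2 :> R.
Proof.
move=> kn; have -> : n = (k + (n - k).-1.+1)%N by lia.
pose f s : R := (nth false s 0)%:R.
rewrite -(@eq_mean _ _ _ (fun s => f (drop k s))); last first.
  by move=> s; rewrite /f nth_drop addn0.
rewrite coins_drop coinsS /f /=.
by rewrite !(meanC (is_expectation_coins _ _)) addr0.
Qed.

Lemma coins_window M k (f : seq bool -> R) : (k <= M)%N ->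
  coins M.*2.+1 (fun s => f (word (dec M s) (- k%:Z) k.*2.+1)) =
  coins k.*2.+1 f.
Proof.
move=> kM; rewrite -[RHS](@coins_take _ _ (M + k).+1); last by lia.
rewrite -[RHS](coins_drop (M - k)).
have -> : (M - k + (M + k).+1 = M.*2.+1)%N by lia.
by apply: eq_chain => s sM; rewrite word_dec.
Qed.

(* Expected growth of the height at site 0 during [k] steps, as a function of
   the occupation numbers of the sites 1 - k, ..., k. *)
Fixpoint growth (k : nat) (w : seq bool) : R :=
  if k is k'.+1
  then 1 / 2 * (nth false w k' && ~~ nth false w k)%:R +
       coins k'.*2.+1 (fun ts => growth k' (wstep w ts))
  else 0.

Lemma growthS k w : growth k.+1 w =
  1 / 2 * (nth false w k && ~~ nth false w k.+1)%:R +
  coins k.*2.+1 (fun ts => growth k (wstep w ts)).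
Proof. by []. Qed.

Lemma tosses_growth M k h : (k <= M)%N -> height h ->
  tosses M k (fun ts => (evol ts h 0 - h 0)%:~R) =
  growth k (word (occ h) (1 - k%:Z) k.*2).
Proof.
elim: k h => [|k IH] h kM hh; first by rewrite /tosses /coins /= subrr.
have tE := is_expectation_tosses R M k.
have cE n := is_expectation_coins R n.
rewrite tossesS.
(* The growth splits into the increment of the first step, where entry [M] of the row is the coin at
   site 0, and the later growth. That coin also enters [wstep], so the two terms are averaged
   separately by linearity. *)
rewrite (@eq_mean _ _ _ _ (fun s =>
  growth k (wstep (word (occ h) (- k%:Z) k.*2.+2) (word (dec M s) (- k%:Z) k.*2.+1))
  + (occ h 0 && ~~ occ h 1)%:R * (nth false s M)%:R)).
  rewrite (meanD (cE _)) (meanZ (cE _)) coins_nth; last by lia.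
  rewrite (coins_window (fun ts => growth k (wstep _ ts))); last by lia.
  rewrite growthS doubleS; have -> : 1 - k.+1%:Z = - k%:Z by lia.
  rewrite addrC mulrC; congr (_ * _%:R + _).
  rewrite !nth_mkseq ?addNr; try by lia.
  by have -> : - k%:Z + k.+1%:Z = 1 by lia.
move=> s; rewrite wstep_word (addrC _ 1) -occ_hstep// -IH; last 2 first.
- by lia.
- exact: height_hstep.
rewrite -[X in _ + X](meanC tE) -(meanD tE); apply: eq_mean => ts /=.
have -> : (nth false s M)%:R = (dec M s 0)%:R :> R by rewrite /dec add0r.
rewrite -natrM mulnb -andbA; set b := [&& _, _ & _].
have -> : b%:R = (hstep (dec M s) h 0 - h 0)%:~R :> R.
  by rewrite hstep_incr// natz -pmulrn.
by rewrite -intrD; congr (_%:~R); rewrite addrA subrK.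
Qed.

Section Stat.
Variables (rho y : R).
Hypotheses (rho_gt0 : 0 < rho) (rho_lt1 : rho < 1).
Hypotheses (y_ge0 : 0 <= y) (y_le : y <= rho) (y_le' : y <= 1 - rho).
Hypothesis y_root : y ^+ 2 - 2 * y + 2 * rho * (1 - rho) = 0.

Let stat := stationary_mean rho y.
Let chain := chain (up rho y).

Let up01 := up01 rho_gt0 rho_lt1 y_ge0 y_le y_le'.
Let cE n b : is_expectation (chain n b) := is_expectation_chain up01 n b.
Let sE n : is_expectation (stat n) :=
  is_expectation_stat rho_gt0 rho_lt1 y_ge0 y_le y_le' n.

(** By [stat_wstep] the law is the same before every step, and each step adds half the probability
    [y] of seeing a particle followed by a hole. *)
Lemma stat_growth k : stat k.*2 (growth k) = k%:R * (y / 2).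
Proof.
elim: k => [|k IH]; first by rewrite (meanC (sE _)) mul0r.
rewrite doubleS /= (meanD (sE _)) (meanZ (sE _)) /stat stat_wstep// -/stat IH.
have -> : k.*2.+2 = (k + k.+2)%N by lia.
by rewrite /stat stat_jump// -natr1; field.
Qed.

Let num (s : seq bool) : R := (count id s)%:R.

Lemma stat_count L : stat L num = rho * L%:R.
Proof.
elim: L => [|L IH]; first by rewrite /stat /stationary_mean /num /=; ring.
rewrite /stat stat_cons// /num /= -!/(chain _ _ _).
rewrite (@eq_mean _ _ (chain L true) _ (fun s => 1 + num s)); last first.
  by move=> s; rewrite natrD.
rewrite (@eq_mean _ _ (chain L false) _ num)//.
have -> : rho * L.+1%:R = stat L num + rho by rewrite IH -natr1; ring.
by rewrite (meanD (cE _ _)) (meanC (cE _ _)) /stat /stationary_mean /chain; ring.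
Qed.

Let chain_num L b : chain L.+1 b num =
  up rho y b * (1 + chain L true num) + (1 - up rho y b) * chain L false num.
Proof.
rewrite /chain chainS -!/(chain _ _ _) -[X in _ * (X + _)](meanC (cE L true)).
by rewrite -(meanD (cE L true)); congr (_ * _ + _); apply: eq_mean => s; rewrite /num /= natrD.
Qed.

(** The gap for [L.+1] is [up true - up false] times 1 plus the gap for [L], a product of factors in
    [-1, 0] and [0, 1]. *)
Let chain_num_gap L : -1 <= chain L true num - chain L false num <= 0.
Proof.
elim: L => [|L IH]; first by rewrite /chain /= subrr; lra.
by have := up_gap rho_gt0 rho_lt1 y_ge0 y_le y_le' y_root; rewrite !chain_num; nra.
Qed.

Let variance_chain_num L b : variance (chain L b) num <= L%:R.
Proof.
elim: L b => [|L IH] b; first by rewrite /variance /chain /= subrr expr0n.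
pose E := mix (up rho y b) (fun f : bool -> R => f true) (fun f => f false).
rewrite -natr1; apply: (@variance_comp_le _ _ _ _ E (chain L) cons num _
  (chain L false num)) => //.
- by apply: is_expectation_mix => //; exact: is_expectation_dirac.
- move=> c; apply: le_trans (IH c).
  rewrite /variance le_eqVlt; apply/orP; left; apply/eqP.
  have -> : (fun s => num (c :: s)) = (fun s => c%:R + num s).
    by apply/funext => s; rewrite /num /= natrD.
  rewrite (meanD (cE _ _)) (meanC (cE _ _)).
  by apply: eq_mean => s; rewrite {1}/num /= natrD; congr (_ ^+ 2); ring.
move=> c; have -> : (fun s => num (c :: s)) = (fun s => c%:R + num s).
  by apply/funext => s; rewrite /num /= natrD.
rewrite (meanD (cE _ _)) (meanC (cE _ _)).
by have := chain_num_gap L; case: c => /=; lra.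
Qed.

Lemma variance_stat_count L : variance (stat L) num <= L%:R + 1.
Proof.
pose E := mix rho (fun f : bool -> R => f true) (fun f => f false).
apply: (@variance_comp_le _ _ _ _ E (chain L) (fun=> id) num _
  (chain L true num)) => //.
- by apply: is_expectation_mix; rewrite ?ltW//; exact: is_expectation_dirac.
by move=> c; have := chain_num_gap L; case: c => /=; lra.
Qed.

End Stat.
End Growth.

(** * Mean height of the step profile *)

Section Bounds.
Variable R : realType.

(* By translation invariance, also the mean number of particles to the right of
   [- j] at time [n] in the process started from x^*. *)
Definition mean_cone n j : R := tosses n n (fun ts => (evol ts (cone j) 0)%:~R).

Lemma mean_cone_mono n i j : i <= j -> mean_cone n i <= mean_cone n j.
Proof.
move=> ij; apply: (ler_mean (is_expectation_tosses R n n)) => ts.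
by rewrite ler_int; apply: le_evol => z; rewrite /cone; lia.
Qed.

Lemma mean_cone_lipschitz n i j : i <= j ->
  mean_cone n j <= mean_cone n i + (j - i)%:~R.
Proof.
have tE := is_expectation_tosses R n n.
move=> ij; rewrite -[X in _ + X](meanC tE) -(meanD tE); apply: (ler_mean tE) => ts.
rewrite -intrD ler_int addrC -evolD.
by apply: le_evol => z; rewrite /cone; lia.
Qed.

Lemma mean_cone_ge n j : (Num.max 0 j)%:~R <= mean_cone n j.
Proof.
have tE := is_expectation_tosses R n n.
rewrite -[leLHS](meanC tE); apply: (ler_mean tE) => ts.
rewrite ler_int; have := evol_bounds ts 0 (height_cone j).
by rewrite {1}/cone subr0 => /andP[].
Qed.

Section Stat.
Variables (rho y : R).
Hypotheses (rho_gt0 : 0 < rho) (rho_lt1 : rho < 1).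
Hypotheses (y_ge0 : 0 <= y) (y_le : y <= rho) (y_le' : y <= 1 - rho).
Hypothesis y_root : y ^+ 2 - 2 * y + 2 * rho * (1 - rho) = 0.
Variable n : nat.

Let stat := stationary_mean rho y.
Let sE k : is_expectation (stat k) :=
  is_expectation_stat rho_gt0 rho_lt1 y_ge0 y_le y_le' k.
Let K := (n * n.*2.+1)%N.
Let kE : is_expectation (coins K) := is_expectation_coins R K.

Let joint (f : seq bool * seq bool -> R) : R :=
  stat n.*2 (fun w => coins K (fun s => f (w, s))).

Let jE : is_expectation joint := is_expectation_comp pair (sE _) (fun=> kE).

Let hini (j : int) (p : seq bool * seq bool) : R := (hinit n p.1 j)%:~R.
Let hcone (j : int) (p : seq bool * seq bool) : R :=
  (evol (rows n n p.2) (cone j) 0)%:~R.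
Let hend (p : seq bool * seq bool) : R :=
  (evol (rows n n p.2) (hinit n p.1) 0)%:~R.

Let jointl f : joint (fun p => f p.1) = stat n.*2 f.
Proof. by rewrite /joint; apply: eq_mean => w /=; rewrite (meanC kE). Qed.

Let jointr f : joint (fun p => f p.2) = coins K f.
Proof. by rewrite /joint /= (meanC (sE _)). Qed.

Let mean_hcone j : joint (hcone j) = mean_cone n j.
Proof. exact: (jointr (fun s => (evol (rows n n s) (cone j) 0)%:~R)). Qed.

Let variance_hcone j : variance joint (hcone j) <= n%:R.
Proof.
rewrite /variance mean_hcone.
have -> := jointr (fun s => ((evol (rows n n s) (cone j) 0)%:~R - mean_cone n j) ^+ 2).
exact: (variance_evol R n n 0 (height_cone j)).
Qed.

Let num (s : seq bool) : R := (count id s)%:R.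

Let hiniE j p : hini j p = - num (take `|(Num.max 0 (j + n%:Z))%R|%N p.1).
Proof. by rewrite /hini /hinit intrN -pmulrn. Qed.

Let mean_hini j : - n%:Z <= j <= n%:Z ->
  joint (hini j) = - (rho * (j%:~R + n%:R)).
Proof.
move=> jn; rewrite (@eq_mean _ _ joint _ _ (hiniE j)).
rewrite (jointl (fun w => - num (take `|(Num.max 0 (j + n%:Z))%R|%N w))).
rewrite (meanN (sE _)) /stat stat_take//; last by lia.
rewrite stat_count// natr_absz.
have -> : `|Num.max 0 (j + n%:Z)| = j + n%:Z by lia.
by rewrite intrD -pmulrn.
Qed.

Let variance_hini j : - n%:Z <= j <= n%:Z ->
  variance joint (hini j) <= n.*2.+1%:R.
Proof.
move=> jn; set k := `|(Num.max 0 (j + n%:Z))%R|%N.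
have kn : (k <= n.*2)%N by lia.
have -> : variance joint (hini j) = variance (stat k) num.
  rewrite /variance.
  have -> : joint (hini j) = - stat k num.
    rewrite (@eq_mean _ _ joint _ _ (hiniE j)).
    rewrite (jointl (fun w => - num (take k w))) (meanN (sE _)).
    by rewrite /stat stat_take.
  have -> : (fun p => (hini j p - - stat k num) ^+ 2) =
      (fun p => (num (take k p.1) - stat k num) ^+ 2).
    by apply/funext => p; rewrite hiniE -/k; ring.
  rewrite (jointl (fun w => (num (take k w) - stat k num) ^+ 2)).
  by rewrite {1}/stat (stat_take _ _ _ _ _ (fun s => (num s - stat k num) ^+ 2)).
apply: le_trans (variance_stat_count rho_gt0 rho_lt1 y_ge0 y_le y_le' y_root k) _.
by rewrite natr1 ler_nat ltnS.
Qed.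

Let mean_growth : joint hend - joint (hini 0) = n%:R * (y / 2).
Proof.
rewrite -(meanB jE) -(stat_growth rho_gt0 rho_lt1 y_ge0 y_le y_le' y_root n).
have eq_stat L f g : (forall s, size s = L -> f s = g s) -> stat L f = stat L g.
  by move=> fg; rewrite /stat /stationary_mean !(eq_chain _ _ fg).
rewrite /joint; apply: eq_stat => w wn; rewrite -[in RHS](word_hinit wn).
rewrite -(tosses_growth _ (leqnn n) (height_hinit n w)).
by apply: eq_mean => s; rewrite /hend /hini /= intrB.
Qed.

Let n0n : - n%:Z <= 0 <= n%:Z. Proof. by lia. Qed.

Lemma mean_cone_ge_flux j : - n%:Z <= j <= n%:Z ->
  n%:R * (y / 2) + rho * j%:~R <= mean_cone n j.
Proof.
move=> jn; rewrite -mean_growth -mean_hcone mean_hini//.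
have -> : rho * j%:~R = - joint (hini j) - rho * n%:R by rewrite mean_hini//; ring.
have : joint hend <= joint (hini j) + joint (hcone j).
  rewrite -(meanD jE); apply: (ler_mean jE) => p.
  rewrite -intrD ler_int; apply: evol_le_cone; exact: height_hinit.
by lra.
Qed.

(* The minimum over j in evol_cone_le is localized on a grid of mesh [m], so
   that only a bounded number of fluctuations has to be controlled. *)
Lemma mean_cone_le_flux (m : nat) (c D : R) : (0 < m)%N -> 0 < c ->
  (forall j : int, - n%:Z <= j <= n%:Z -> D <= mean_cone n j - rho * j%:~R) ->
  D <= n%:R * (y / 2) + m%:R + (n.*2 %/ m).+1%:R * (2 * (c + n.*2.+1%:R / c)).
Proof.
move=> m0 c0 leD; set N := (n.*2 %/ m).+1.
pose g (r : nat) : int := - n%:Z + (r * m)%:Z.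
have gn r : (r < N)%N -> - n%:Z <= g r <= n%:Z.
  rewrite ltnS => rN; have : (r * m <= n.*2)%N.
    by apply: leq_trans (leq_trunc_div n.*2 m); rewrite leq_mul2r rN orbT.
  by rewrite /g; lia.
(* Two heights fluctuate at each of the [N] grid points, and [mean_normB_le] bounds each mean
   deviation; this is the source of the factor 2 in the error. *)
pose dev p : R := \sum_(r < N) (`|hcone (g r) p - joint (hcone (g r))| +
                                `|hini (g r) p - joint (hini (g r))|).
have dev_le : joint dev <= N%:R * (2 * (c + n.*2.+1%:R / c)).
  rewrite (mean_sum jE) (@le_trans _ _ (\sum_(r < N) 2 * (c + n.*2.+1%:R / c)))//.
    apply: ler_sum => r _; rewrite (meanD jE) mulr_natl mulr2n lerD//.
      apply: mean_normB_le => //; apply: le_trans (variance_hcone _) _.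
      by rewrite ler_nat; lia.
    by apply: mean_normB_le => //; exact/variance_hini/gn.
  by rewrite sumr_const card_ord (mulr_natl _ N).
have main p : D - rho * n%:R - m%:R - dev p <= hend p.
  have hh := height_hinit n p.1.
  have [j] := evol_cone_le (rows n n p.2) 0 hh.
  rewrite size_rows subr0 => jn le_hend.
  pose r := (`|(j + n%:Z)%R|%N %/ m)%N.
  have rN : (r < N)%N by rewrite ltnS leq_div2r//; lia.
  have [k jg km] : exists2 k : nat, j = g r + k%:Z & (k <= m)%N.
    exists (`|(j + n%:Z)%R|%N %% m)%N; last by rewrite ltnW// ltn_mod.
    by have := divn_eq `|(j + n%:Z)%R|%N m; rewrite /g -/r; lia.
  (* Rounding [j] down to the grid raises the initial height by at most [m] and cannot raise the
     cone height. *)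
  have hini_le : hini (g r) p <= hini j p + m%:R.
    rewrite /hini [m%:R]pmulrn -intrD ler_int jg.
    by have := height_lipschitz (g r) k hh; lia.
  have hcone_le : hcone (g r) p <= hcone j p.
    by rewrite /hcone ler_int; apply: le_evol => z; rewrite /cone; lia.
  have hend_ge : hini j p + hcone j p <= hend p.
    by rewrite /hini /hcone /hend -intrD ler_int.
  have dev_ge : `|hcone (g r) p - joint (hcone (g r))| +
      `|hini (g r) p - joint (hini (g r))| <= dev p.
    rewrite /dev (bigD1 (Ordinal rN))//= lerDl; apply: sumr_ge0 => i _.
    by rewrite addr_ge0 ?normr_ge0.
  have := leD _ (gn _ rN).
  have := lerNnormlW (lexx `|hcone (g r) p - joint (hcone (g r))|).
  have := lerNnormlW (lexx `|hini (g r) p - joint (hini (g r))|).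
  rewrite mean_hini ?gn// mean_hcone in dev_ge *.
  by lra.
have : D - rho * n%:R - m%:R - joint dev <= joint hend.
  rewrite -[X in X - joint dev](meanC jE) -(meanB jE).
  exact: (ler_mean jE).
by have := mean_growth; rewrite mean_hini//; lra.
Qed.

End Stat.
End Bounds.

(** * Error terms of lower order and Legendre duality *)

Section Asymptotics.
Variable R : realType.

Lemma eventually_natr (A : R) : exists N, forall n, (N <= n)%N -> A <= n%:R.
Proof.
exists (Num.truncn A).+1 => n An; apply/ltW/(lt_le_trans (truncnS_gt A)).
by rewrite ler_nat.
Qed.

(* The stationary probability of seeing a particle followed by a hole; the current
   is half of it. *)
Definition pair_density (rho : R) : R := 1 - Num.sqrt (1 - 2 * rho * (1 - rho)).

Lemma pair_density_spec rho : 0 < rho -> rho < 1 ->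
  [/\ 0 <= pair_density rho, pair_density rho <= rho, pair_density rho <= 1 - rho &
      pair_density rho ^+ 2 - 2 * pair_density rho + 2 * rho * (1 - rho) = 0].
Proof.
move=> r0 r1; rewrite /pair_density; set q := 1 - 2 * rho * (1 - rho).
have q0 : 0 <= q by rewrite /q; nra.
have s0 := sqrtr_ge0 q; have := sqr_sqrtr q0; move: (Num.sqrt q) s0 => s s0 sq.
by split; move: sq; rewrite /q; nra.
Qed.

Lemma mean_cone_le_eventually rho kappa : 0 < rho -> rho < 1 -> 0 < kappa ->
  exists N, forall n, (N <= n)%N -> forall D : R,
  (forall j : int, - n%:Z <= j <= n%:Z -> D <= mean_cone R n j - rho * j%:~R) ->
  D <= n%:R * (pair_density rho / 2) + kappa * n%:R.
Proof.
move=> r0 r1 k0; have [y0 y1 y2 y3] := pair_density_spec r0 r1.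
(* A mesh proportional to [n] leaves at most [G] grid points, and deviations are cut at [delta * n].
   Mesh and deviations each cost [kappa / 4 * n] up to constants, which [kappa / 2 * n] absorbs for
   large [n]. *)
pose eps := kappa / 4; pose G := 2 / eps + 1; pose delta := kappa / (8 * G).
have e0 : 0 < eps by rewrite /eps; lra.
have G0 : 0 < G by rewrite /G ltr_pwDr// divr_ge0// ltW.
have d0 : 0 < delta by rewrite /delta divr_gt0// mulr_gt0.
have [N1 HN1] := eventually_natr ((1 + 6 * G / delta) * (2 / kappa)).
exists N1.+1 => n N1n D leD.
have n1 : 1 <= n%:R :> R by rewrite ler1n; lia.
have n0 : 0 < n%:R :> R by lra.
pose m := (Num.truncn (eps * n%:R)).+1.
have [mle mgt] : m%:R <= eps * n%:R + 1 /\ eps * n%:R <= m%:R.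
  have := truncn_itv (mulr_ge0 (ltW e0) (ltW n0)).
  by rewrite -/m -natr1 => /andP[? ?]; split; lra.
have m0 : 0 < m%:R :> R by rewrite ltr0n.
have Nle : (n.*2 %/ m).+1%:R <= G.
  rewrite -natr1 /G lerD2r ler_pdivlMr//.
  have : ((n.*2 %/ m) * m)%:R <= n.*2%:R :> R by rewrite ler_nat leq_trunc_div.
  have : 0 <= (n.*2 %/ m)%:R :> R by [].
  rewrite natrM -muln2 natrM; move: (_ %/ _)%N%:R => Q Q0 Qm.
  rewrite -(ler_pM2r n0); apply: le_trans (_ : Q * m%:R <= _); last by lra.
  by rewrite -mulrA ler_wpM2l.
have := mean_cone_le_flux r0 r1 y0 y1 y2 y3 (ltn0Sn _) (mulr_gt0 d0 n0) leD.
move/(_ (Num.truncn (eps * n%:R))); rewrite -/m.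
set err := 2 * _ => le_D.
have err_le : err <= 2 * (delta * n%:R + 3 / delta).
  rewrite /err ler_pM2l// lerD2l ler_pdivrMr; last exact: mulr_gt0.
  rewrite mulrA divfK ?gt_eqF//.
  by rewrite -natr1 -addnn natrD; lra.
have err0 : 0 <= err.
  have c0 := ltW (mulr_gt0 d0 n0).
  by rewrite /err mulr_ge0// addr_ge0// divr_ge0.
have : (n.*2 %/ m).+1%:R * err <= G * (2 * (delta * n%:R + 3 / delta)).
  by apply: ler_pM.
have -> : G * (2 * (delta * n%:R + 3 / delta)) =
  kappa / 4 * n%:R + 6 * G / delta.
  by rewrite /delta; field; rewrite !gt_eqF.
have : 1 + 6 * G / delta <= kappa / 2 * n%:R.
  have := HN1 n (ltnW N1n).
  by rewrite mulrA ler_pdivrMr//; lra.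
by move: le_D mle; rewrite /eps; lra.
Qed.

(* The maximizer over [rho] of [pair_density rho / 2 - rho * u]. *)
Definition dual_density (u : R) : R := 1 / 2 - u / (2 * Num.sqrt (1 / 2 - u ^+ 2)).

Let sqrt_half u : - (1 / 2) < u < 1 / 2 ->
  [/\ 1 / 2 <= Num.sqrt (1 / 2 - u ^+ 2) :> R, Num.sqrt (1 / 2 - u ^+ 2) <= 1 :> R,
   Num.sqrt (1 / 2 - u ^+ 2) ^+ 2 = 1 / 2 - u ^+ 2 & `|u| < Num.sqrt (1 / 2 - u ^+ 2)].
Proof.
move=> /andP[u0 u1]; have q0 : 0 <= 1 / 2 - u ^+ 2 by nra.
have s0 := sqrtr_ge0 (1 / 2 - u ^+ 2); have := sqr_sqrtr q0.
move: (Num.sqrt _) s0 => s s0 sq.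
have s1 : 1 / 2 <= s by nra.
split => //; first by nra.
by rewrite ltr_norml; apply/andP; split; lra.
Qed.

(** In the last clause, moving the density by [tau] loses at most [tau ^+ 2] against the tangent
    line of slope [u]; this quadratic loss is later beaten by a gain linear in [tau] at sites away
    from [- u * n]. *)
Lemma dual_density_spec u : - (1 / 2) < u < 1 / 2 ->
  [/\ 0 < dual_density u, dual_density u < 1,
   pair_density (dual_density u) / 2 - dual_density u * u = tasep_h u &
   forall tau, pair_density (dual_density u) / 2 + tau * u - tau ^+ 2 <=
     pair_density (dual_density u + tau) / 2].
Proof.
move=> u12; have [r1 r2 r3 r4] := sqrt_half u12.
case/andP: u12 => u1 u2.
rewrite /tasep_h (ltNge u) (ltW u1) (ltW u2) /= /dual_density.
move: (Num.sqrt (1 / 2 - u ^+ 2)) r1 r2 r3 r4 => r r1 r2 r3 r4.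
have r0 : 0 < r by lra.
have rn0 : r != 0 by rewrite gt_eqF.
(* [a] is the square root occurring in [pair_density] at the dual density, which equals
   [1 / 2 - a * u]. *)
pose a := (2 * r)^-1; have ar : a * r = 1 / 2 by rewrite /a; field.
have a0 : 0 < a by rewrite /a invr_gt0; lra.
have a1 : 1 / 2 <= a by nra.
have au : `|a * u| < 1 / 2.
  by rewrite normrM (gtr0_norm a0) -ar ltr_pM2l.
move: au; rewrite ltr_norml => /andP[au1 au2].
have -> : u / (2 * r) = a * u by rewrite mulrC.
have pdE tau : pair_density (1 / 2 - a * u + tau) =
    1 - Num.sqrt (a ^+ 2 - 4 * u * a * tau + 2 * tau ^+ 2).
  rewrite /pair_density; congr (1 - Num.sqrt _).
  have : a ^+ 2 * (r ^+ 2 + u ^+ 2) = a ^+ 2 / 2 by rewrite r3; ring.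
  rewrite mulrDr -exprMn ar; lra.
have pd0 : pair_density (1 / 2 - a * u) = 1 - a.
  by rewrite -[_ - _]addr0 pdE mulr0 subr0 expr0n mulr0 addr0 sqrtr_sqr gtr0_norm.
split; [lra | lra | |].
- rewrite pd0; have : a * (r ^+ 2 + u ^+ 2) = a / 2 by rewrite r3; ring.
  have : a * r ^+ 2 = r / 2 by rewrite expr2 mulrA ar; lra.
  lra.
move=> tau; rewrite pd0 pdE.
set q := a ^+ 2 - _ + _; pose b := a - 2 * tau * u + 2 * tau ^+ 2.
have b0 : 0 <= b by rewrite /b; nra.
suff : Num.sqrt q <= b by rewrite /b; lra.
rewrite -[b]ger0_norm// -sqrtr_sqr ler_wsqrtr// /q /b.
(* [b ^+ 2 - q] is this square plus [(4 * a - 2) * tau ^+ 2], and [1 / 2 <= a]. *)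
have := sqr_ge0 (- 2 * tau * u + 2 * tau ^+ 2).
have : 0 <= (4 * a - 2) * tau ^+ 2 by rewrite mulr_ge0 ?sqr_ge0//; lra.
nra.
Qed.

End Asymptotics.

(** * Law of large numbers for the height of the step profile *)

Section Limit.
Variable R : realType.

(** The lower bound is [mean_cone_ge_flux] at the dual density. For the upper bound,
    [mean_cone_le_eventually] needs a [D] valid at all sites: near [j] the Lipschitz bound and
    monotonicity provide it, far from [j] the flux bound at a perturbed density. *)
Lemma mean_cone_cvg_mid (u eps : R) : - (1 / 2) < u < 1 / 2 -> 0 < eps ->
  exists N, forall n, (N <= n)%N -> forall j : int, `|j%:~R + u * n%:R| <= 1 ->
  `|mean_cone R n j - tasep_h u * n%:R| <= eps * n%:R.
Proof.
move=> u12 e0; have [r0 r1 hE tangent] := dual_density_spec u12.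
move: (dual_density u) r0 r1 hE tangent => rho r0 r1 hE tangent.
pose eta := eps / 8; have eta0 : 0 < eta by rewrite /eta; lra.
have [tau [t0 t_eta t1 t2]] :
    exists tau, [/\ 0 < tau, tau <= eta / 2, 0 < rho - tau & rho + tau < 1].
  pose tau := Num.min (eta / 2) (Num.min (rho / 2) ((1 - rho) / 2)).
  have t0 : 0 < tau by rewrite !lt_min; lra.
  have [t1 t2 t3] : [/\ tau <= eta / 2, tau <= rho / 2 & tau <= (1 - rho) / 2].
    by rewrite !ge_min !lexx !orbT.
  by exists tau; split; lra.
pose kappa := Num.min (tau * eta / 8) (eps / 4).
have te0 : 0 < tau * eta by rewrite mulr_gt0.
have k0 : 0 < kappa by rewrite lt_min; lra.
have [k1 k2] : kappa <= tau * eta / 8 /\ kappa <= eps / 4.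
  by rewrite !ge_min !lexx orbT.
have [N1 HN1] := mean_cone_le_eventually r0 r1 k0.
have [N2 HN2] := eventually_natr (8 / eta).
have [N3 HN3] := eventually_natr (4 / eps).
exists (maxn N1 (maxn N2 (maxn N3 2))) => n.
rewrite !geq_max => /and4P[/HN1 le_D /HN2 n_eta /HN3 n_eps n2] j ju.
have n2R : 2 <= n%:R :> R by rewrite (ler_nat R 2).
have n0 : 0 <= n%:R :> R by lra.
have eta_n : 8 <= eta * n%:R by move: n_eta; rewrite ler_pdivrMr// mulrC.
have eps_n : 4 <= eps * n%:R by move: n_eps; rewrite ler_pdivrMr// mulrC.
move: ju; rewrite ler_norml => /andP[ju1 ju2].
case/andP: u12 => u1 u2.
have un1 : - (n%:R / 2) <= u * n%:R by nra.
have un2 : u * n%:R <= n%:R / 2 by nra.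
have jn : - n%:Z <= j <= n%:Z.
  by rewrite -!(ler_int R) intrN -pmulrn; apply/andP; split; lra.
have rj1 := ler_wpM2l (ltW r0) ju1; have rj2 := ler_wpM2l (ltW r0) ju2.
have hnE : tasep_h u * n%:R = pair_density rho / 2 * n%:R - rho * (u * n%:R).
  by rewrite -hE; ring.
have [y0 y1 y2 y3] := pair_density_spec r0 r1.
have lower := mean_cone_ge_flux r0 r1 y0 y1 y2 y3 jn.
rewrite ler_norml; apply/andP; split; first by lra.
pose D1 := mean_cone R n j - rho * j%:~R - 2 * eta * n%:R.
pose D2 := n%:R * (pair_density rho / 2) + (tau * eta) / 2 * n%:R - tau.
(* The sign [s] tells on which side of [j] the site lies; density [rho + s * tau] gains about
   [tau * eta * n] there, and [tau <= eta / 2] keeps the loss [tau ^+ 2 * n] below half of it. *)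
have side s (i : int) : - n%:Z <= i <= n%:Z -> 0 < rho + s * tau -> rho + s * tau < 1 ->
    s ^+ 2 = 1 -> eta * n%:R - 1 <= s * (u * n%:R + i%:~R) ->
    D2 <= mean_cone R n i - rho * i%:~R.
  move=> iN s0 s1 ss s_le.
  have [y0' y1' y2' y3'] := pair_density_spec s0 s1.
  have := mean_cone_ge_flux s0 s1 y0' y1' y2' y3' iN.
  have := ler_wpM2l n0 (tangent (s * tau)).
  have := ler_wpM2l (ltW t0) s_le.
  have := ler_wpM2l (mulr_ge0 (ltW t0) n0) t_eta.
  by rewrite exprMn ss /D2; lra.
have : Num.min D1 D2 <= n%:R * (pair_density rho / 2) + kappa * n%:R.
  apply: le_D => i iN; rewrite ge_min.
  have [far|] := ltP (eta * n%:R) (i - j)%:~R.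
    apply/orP; right; apply: (side 1) => //; rewrite ?expr1n//; lra.
  rewrite intrB => near1.
  have [far|near2] := ltP (eta * n%:R) (j - i)%:~R.
    apply/orP; right; apply: (side (-1)) => //; rewrite ?sqrrN ?expr1n//; lra.
  apply/orP; left; rewrite /D1.
  move: near2; rewrite intrB => near2.
  have : rho * (i%:~R - j%:~R) <= 1 * (eta * n%:R).
    have eta_n0 : 0 <= eta * n%:R by lra.
    apply: le_trans (ler_wpM2r eta_n0 (ltW r1)).
    exact: (ler_wpM2l (ltW r0) near1).
  have [ij|ji] := leP i j.
    have := mean_cone_lipschitz R n ij; rewrite intrB; lra.
  by have := mean_cone_mono R n (ltW ji); lra.
have kn1 := ler_wpM2r n0 k1; have kn2 := ler_wpM2r n0 k2.
(* [D2] cannot be the smaller one: its excess [tau * eta / 2 * n - tau] beats [kappa * n], because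
   [kappa <= tau * eta / 8] and [8 <= eta * n]. *)
rewrite ge_min => /orP[]; first by rewrite /D1 /eta; lra.
have := ler_wpM2l (ltW t0) eta_n.
by rewrite /D2; lra.
Qed.

Let sqrt_quarter : 1 / 2 = Num.sqrt (1 / 4) :> R.
Proof.
have -> : 1 / 4 = (1 / 2) ^+ 2 :> R by field.
by rewrite sqrtr_sqr ger0_norm//; lra.
Qed.

Lemma tasep_h_right (u : R) : 1 / 2 <= u -> tasep_h u = 0.
Proof.
move=> u1; rewrite /tasep_h ltNge (_ : - (1 / 2) <= u)/=; last by lra.
case: leP => // u2; have -> : u = 1 / 2 by lra.
have -> : 1 / 2 - (1 / 2) ^+ 2 = 1 / 4 :> R by field.
by rewrite -sqrt_quarter; field.
Qed.

Lemma tasep_h_left (u : R) : u <= - (1 / 2) -> tasep_h u = - u.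
Proof.
move=> u1; rewrite /tasep_h; case: ltP => // u2.
have -> : u = - (1 / 2) by lra.
rewrite (_ : (- (1 / 2) : R) <= 1 / 2); last by lra.
have -> : 1 / 2 - (- (1 / 2)) ^+ 2 = 1 / 4 :> R by field.
by rewrite -sqrt_quarter; field.
Qed.

Lemma tasep_h_edge (d : R) : 0 < d -> d <= 1 / 2 ->
  tasep_h (1 / 2 - d) <= d / 2 /\ tasep_h (- (1 / 2) + d) <= 1 / 2 - d / 2.
Proof.
move=> d0 d1.
have sq v : v ^+ 2 <= 1 / 4 -> 1 / 2 <= Num.sqrt (1 / 2 - v ^+ 2) :> R.
  by move=> v1; rewrite [leLHS]sqrt_quarter ler_wsqrtr//; lra.
rewrite /tasep_h; split.
  rewrite ltNge (_ : - (1 / 2) <= _)/=; last by lra.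
  rewrite (_ : _ <= 1 / 2); last by lra.
  by have := sq (1 / 2 - d); nra.
rewrite ltNge (_ : - (1 / 2) <= _)/=; last by lra.
rewrite (_ : _ <= 1 / 2); last by lra.
by have := sq (- (1 / 2) + d); nra.
Qed.

Let ceilN (x : R) : `|(Num.ceil (- x))%:~R + x| <= 1.
Proof.
have /andP[] := ceil_itv (- x); rewrite intrB => c1 c2.
by rewrite ler_norml; apply/andP; split; lra.
Qed.

(** Outside the open interval the trivial bound [mean_cone_ge] is sharp. The upper bound compares
    with a velocity at distance [d] inside the interval, by monotonicity in [j] on the right and the
    Lipschitz bound on the left. *)
Lemma mean_cone_cvg (u eps : R) : 0 < eps ->
  exists N, forall n, (N <= n)%N -> forall j : int, `|j%:~R + u * n%:R| <= 1 ->
  `|mean_cone R n j - tasep_h u * n%:R| <= eps * n%:R.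
Proof.
move=> e0; pose d := Num.min (eps / 2) (1 / 2).
have d0 : 0 < d by rewrite lt_min; lra.
have [d1 d2] : d <= eps / 2 /\ d <= 1 / 2 by rewrite !ge_min !lexx orbT.
have e2 : 0 < eps / 2 by lra.
have [h1 h2] := tasep_h_edge d0 d2.
have [N2 HN2] := eventually_natr (2 / d).
have [u1|u1] := leP (1 / 2) u.
  have v12 : - (1 / 2) < 1 / 2 - d < 1 / 2 by lra.
  have [N1 HN1] := mean_cone_cvg_mid v12 e2.
  exists (maxn N1 N2) => n; rewrite geq_max => /andP[/HN1 H /HN2 nd] j ju.
  have n0 : 0 <= n%:R :> R by [].
  have dn : 2 <= d * n%:R by move: nd; rewrite ler_pdivrMr// mulrC.
  rewrite tasep_h_right// mul0r subr0.
  have := mean_cone_ge R n j; have := H _ (ceilN ((1 / 2 - d) * n%:R)).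
  set i := Num.ceil _ => Hi m0.
  have ji : j <= i.
    rewrite -(ler_int R); have := ceil_ge (- ((1 / 2 - d) * n%:R)); rewrite -/i.
    move: ju; rewrite ler_norml => /andP[_].
    by have := ler_wpM2r n0 u1; lra.
  have := mean_cone_mono R n ji; have := ler_wpM2r n0 h1.
  have := ler_wpM2r n0 d1.
  move: Hi; rewrite !ler_norml => /andP[_].
  have : 0 <= (Num.max 0 j)%:~R :> R by rewrite ler0z le_max lexx.
  by move=> *; apply/andP; split; nra.
have [u2|u2] := leP u (- (1 / 2)); last first.
  by apply: mean_cone_cvg_mid => //; apply/andP.
have v12 : - (1 / 2) < - (1 / 2) + d < 1 / 2 by lra.
have [N1 HN1] := mean_cone_cvg_mid v12 e2.
have [N3 HN3] := eventually_natr (4 / eps).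
exists (maxn N1 (maxn N2 N3)) => n; rewrite !geq_max => /and3P[/HN1 H /HN2 nd /HN3 ne] j ju.
have n0 : 0 <= n%:R :> R by [].
have dn : 2 <= d * n%:R by move: nd; rewrite ler_pdivrMr// mulrC.
have en : 4 <= eps * n%:R by move: ne; rewrite ler_pdivrMr// mulrC.
rewrite tasep_h_left//.
have := mean_cone_ge R n j; have := H _ (ceilN ((- (1 / 2) + d) * n%:R)).
have := ceil_itv (- ((- (1 / 2) + d) * n%:R)).
set i := Num.ceil _ => /andP[]; rewrite intrB => i1 i2 Hi m0.
move: ju; rewrite ler_norml => /andP[j1 j2].
have un := ler_wpM2r n0 u2.
have ij : i <= j by rewrite -(ler_int R); lra.
have := mean_cone_lipschitz R n ij; rewrite intrB; have := ler_wpM2r n0 h2.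
have := ler_wpM2r n0 d1.
move: Hi; rewrite !ler_norml => /andP[_].
have : j%:~R <= (Num.max 0 j)%:~R :> R by rewrite ler_int le_max lexx orbT.
by move=> *; apply/andP; split; lra.
Qed.

Lemma tosses_cone_cvg (u eps delta : R) : 0 < eps -> 0 < delta ->
  exists N, forall n, (N <= n)%N -> forall j : int, `|j%:~R + u * n%:R| <= 1 ->
  tosses n n (fun ts =>
    (eps < `|(evol ts (cone j) 0)%:~R / n%:R - tasep_h u|)%R%:R) <= delta.
Proof.
(* Since [gam ^+ 2 <= delta], the squared bias uses at most half of the Chebyshev budget, and the
   variance, at most [n], fits into the other half for large [n]. *)
move=> e0 d0; pose gam := Num.min 1 delta.
have g0 : 0 < gam by rewrite lt_min; lra.
have [g1 g2] : gam <= 1 /\ gam <= delta by rewrite !ge_min !lexx orbT.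
have e1 : 0 < eps * gam / 2 by rewrite divr_gt0 ?mulr_gt0.
have [N1 HN1] := mean_cone_cvg u e1.
have [N2 HN2] := eventually_natr (2 / (delta * eps ^+ 2)).
exists (maxn N1 N2.+1) => n; rewrite geq_max => /andP[nN1 nN2] j ju.
have n0 : 0 < n%:R :> R by rewrite ltr0n; lia.
have := HN1 n nN1 j ju; have := HN2 n (ltnW nN2) => {HN1 HN2} de mean_le.
have en0 : 0 < eps * n%:R by rewrite mulr_gt0.
have tE := is_expectation_tosses R n n.
rewrite (@eq_mean _ _ _ _ (fun ts =>
    (eps * n%:R < `|(evol ts (cone j) 0)%:~R - tasep_h u * n%:R|)%R%:R)); last first.
  move=> ts; set X := (evol _ _ _)%:~R; congr ((_ : bool)%:R).
  have -> : X / n%:R - tasep_h u = (X - tasep_h u * n%:R) / n%:R.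
    by field; rewrite gt_eqF.
  by rewrite normrM normfV (gtr0_norm n0) ltr_pdivlMr.
apply: le_trans (chebyshev_mean tE _ _ en0) _.
rewrite ler_pdivrMr ?exprn_gt0//.
have var_le := variance_evol R n n 0 (height_cone j).
have bias : (mean_cone R n j - tasep_h u * n%:R) ^+ 2 <= (eps * gam / 2 * n%:R) ^+ 2.
  by rewrite -[leLHS]real_normK ?num_real// lerXn2r ?nnegrE// mulr_ge0// ltW.
have de0 : 0 < delta * eps ^+ 2 by rewrite mulr_gt0 ?exprn_gt0.
have : n%:R <= delta / 2 * (eps * n%:R) ^+ 2.
  have de2 : 2 <= delta * eps ^+ 2 * n%:R.
    by move: de; rewrite ler_pdivrMr// mulrC.
  by have := ler_wpM2r (ltW n0) de2; rewrite exprMn expr2 [n%:R ^+ 2]expr2; lra.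
have : (eps * gam / 2 * n%:R) ^+ 2 <= delta / 2 * (eps * n%:R) ^+ 2.
  have -> : (eps * gam / 2 * n%:R) ^+ 2 = gam ^+ 2 / 4 * (eps * n%:R) ^+ 2 by field.
  by rewrite ler_wpM2r ?sqr_ge0//; nra.
by move: var_le bias; rewrite /mean_cone; lra.
Qed.

End Limit.

(** * Coins and particle counts *)

Section CoinLaw.
Variables (R : realType) (d : measure_display) (T : measurableType d).
Variables (P : probability T R) (coin : nat * int -> {RV P >-> bool}).
Hypothesis coin_fair : forall k, P (coin k @^-1` [set true]) = (1 / 2)%:E.
Hypothesis coin_indep : mutually_independent coin.

Definition outcome (ks : seq (nat * int)) (w : T) : seq bool :=
  [seq coin k w | k <- ks].

Lemma measurable_coin k b : measurable (coin k @^-1` [set b]).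
Proof. exact: measurable_funPTI. Qed.

Lemma measurable_outcome ks (Q : pred (seq bool)) :
  measurable [set w | Q (outcome ks w)].
Proof.
elim: ks Q => [|k ks IH] Q.
  case: (boolP (Q [::])) => q.
    by rewrite (_ : [set _ | _] = setT)//; apply/seteqP; split.
  by rewrite (_ : [set _ | _] = set0)//; apply/seteqP; split => // w /= /(negP q).
have -> : [set w | Q (outcome (k :: ks) w)] =
    (coin k @^-1` [set true] `&` [set w | Q (true :: outcome ks w)]) `|`
    (coin k @^-1` [set false] `&` [set w | Q (false :: outcome ks w)]).
  apply/seteqP; split=> [w|w] /=.
    by case: (coin k w); [left | right].
  by case=> [] [->].
apply: measurableU; apply: measurableI; try exact: measurable_coin.
- exact: (IH (fun s => Q (true :: s))).
- exact: (IH (fun s => Q (false :: s))).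
Qed.

Let cyl (J : {fset nat * int}) (v : nat * int -> bool) : set T :=
  \bigcap_(i in [set` J]) (coin i @^-1` [set v i]).

Let upd (v : nat * int -> bool) k b i := if i == k then b else v i.

Let coin_half k b : P (coin k @^-1` [set b]) = (1 / 2)%:E.
Proof.
case: b; first exact: coin_fair.
have -> : coin k @^-1` [set false] = ~` (coin k @^-1` [set true]).
  by apply/seteqP; split=> w /=; case: (coin k w).
rewrite probability_setC; last exact: measurable_coin.
by rewrite coin_fair -EFinB; congr EFin; field.
Qed.

Let cylU1 J v k b : k \notin J ->
  P (cyl (k |` J)%fset (upd v k b)) = ((1 / 2)%:E * P (cyl J v))%E.
Proof.
move=> kJ; rewrite /cyl !coin_indep => [|//|//].
rewrite big_fsetU1//= coin_half; congr (_ * _)%E.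
apply: eq_big_seq => i iJ; congr (P (_ @^-1` [set _])).
by rewrite /upd; case: eqP => // ik; move: kJ; rewrite -ik iJ.
Qed.

Let cylI J v k b : k \notin J ->
  cyl J v `&` coin k @^-1` [set b] = cyl (k |` J)%fset (upd v k b).
Proof.
move=> kJ; apply/seteqP; split=> w /=.
  case=> wJ wk i /=; rewrite /upd !inE; case: eqP => [-> //|_ /= iJ].
  exact: wJ.
move=> wJ; split; last first.
  by have := wJ k; rewrite /= /upd eqxx; apply; rewrite !inE eqxx.
move=> i /= iJ; have := wJ i; rewrite /= /upd !inE iJ orbT.
by case: eqP => [ik|_]; [move: kJ; rewrite -ik iJ | apply].
Qed.

Let measurable_cyl J v : measurable (cyl J v).
Proof.
apply: fin_bigcap_measurable => [|i _]; last exact: measurable_coin.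
exact: finite_fset.
Qed.

(** The cylinder records the coins already revealed; carrying it along lets the induction reveal one
    fresh coin at a time. *)
Let prob_cyl J v ks (Q : pred (seq bool)) : uniq ks -> {in ks, forall k, k \notin J} ->
  P (cyl J v `&` [set w | Q (outcome ks w)]) =
  (P (cyl J v) * (coins (size ks) (fun s => (Q s)%:R))%:E)%E.
Proof.
elim: ks J v Q => [|k ks IH] J v Q /=.
  move=> _ _; rewrite /coins /=; case: (boolP (Q [::])) => q.
    by rewrite (_ : [set _ | _] = setT) ?setIT ?mule1//; apply/seteqP; split.
  rewrite (_ : [set _ | _] = set0) ?setI0 ?measure0 ?mule0//.
  by apply/seteqP; split => // w /= /(negP q).
case/andP=> kks uks dJ; have kJ : k \notin J by apply: dJ; rewrite inE eqxx.
have dJ' : {in ks, forall i, i \notin (k |` J)%fset}.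
  move=> i iks; rewrite !inE negb_or dJ ?inE ?iks ?orbT// andbT.
  by apply: contraNneq kks => <-.
have -> : cyl J v `&` [set w | Q (outcome (k :: ks) w)] =
    (cyl (k |` J)%fset (upd v k true) `&` [set w | Q (true :: outcome ks w)]) `|`
    (cyl (k |` J)%fset (upd v k false) `&` [set w | Q (false :: outcome ks w)]).
  rewrite -!cylI//; apply/seteqP; split=> [w|w] /=.
    by case: (coin k w) => -[]; [left | right].
  by case=> [] [[? ->]].
rewrite measureU; last 3 first.
- by apply: measurableI => //; exact: (measurable_outcome ks (fun s => Q (true :: s))).
- by apply: measurableI => //; exact: (measurable_outcome ks (fun s => Q (false :: s))).
- rewrite -!cylI//; apply/seteqP; split=> // w /=.
  by case=> -[[_ ->] _] [[_]].
have /= -> := IH _ (upd v k true) (fun s => Q (true :: s)) uks dJ'.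
have /= -> := IH _ (upd v k false) (fun s => Q (false :: s)) uks dJ'.
rewrite !cylU1// coinsS -(fineK (fin_num_measure P _ (measurable_cyl J v))).
by rewrite -!EFinM -EFinD; congr EFin; field.
Qed.

Lemma prob_outcome ks (Q : pred (seq bool)) : uniq ks ->
  P [set w | Q (outcome ks w)] = (coins (size ks) (fun s => (Q s)%:R))%:E.
Proof.
move=> uks; have := @prob_cyl fset0 xpred0 ks Q uks.
have -> : cyl fset0 xpred0 = setT by apply/seteqP; split=> // w _ i.
by rewrite setTI probability_setT mul1e; apply.
Qed.

(* The coins at the sites [i - n, i + n] during the first [n] steps: they
   determine the height at site [i] at time [n]. *)
Definition keys (n : nat) (i : int) : seq (nat * int) :=
  [seq (k, i + z%:Z - n%:Z) | k <- iota 0 n, z <- iota 0 n.*2.+1].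

Lemma uniq_keys n i : uniq (keys n i).
Proof.
apply: allpairs_uniq; rewrite ?iota_uniq// => -[k z] [k' z'] _ _ [-> zz'].
by congr (_, _); lia.
Qed.

Lemma size_keys n i : size (keys n i) = (n * n.*2.+1)%N.
Proof. by rewrite size_allpairs !size_iota. Qed.

Lemma rows_flatten M (f : nat -> seq bool) l : (forall k, size (f k) = M.*2.+1) ->
  rows M (size l) (flatten [seq f k | k <- l]) = [seq dec M (f k) | k <- l].
Proof.
move=> sf; elim: l => //= k l IH.
by rewrite take_size_cat// drop_size_cat// IH.
Qed.

Definition coin_height n (w : T) : int -> int :=
  evol [seq (fun i => coin (k, i) w) | k <- iota 0 n] (cone 0).

(** Translation by [i] moves the observed site to 0 and the initial cone to [- i]; finite speed then
    restricts the coins to the window. *)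
Lemma coin_heightE n w i :
  coin_height n w i = evol (rows n n (outcome (keys n i) w)) (cone (- i)) 0.
Proof.
pose f k := mkseq (fun z => coin (k, i + z%:Z - n%:Z) w) n.*2.+1.
have -> : outcome (keys n i) w = flatten [seq f k | k <- iota 0 n].
  by rewrite /outcome /keys map_allpairs.
have := @rows_flatten n f (iota 0 n) (fun k => size_mkseq _ _).
rewrite size_iota => ->.
rewrite /coin_height -[X in evol _ _ X]add0r -evol_shift -map_comp.
apply: eq_evol_local; rewrite ?size_map ?size_iota//; last first.
  by move=> z _; rewrite /cone; lia.
move=> k z zn; have [kn|nk] := ltnP k n; last first.
  by rewrite !nth_default// size_map size_iota.
rewrite !(nth_map 0%N) ?size_iota// nth_iota//= add0n /dec /f.
rewrite nth_mkseq; last by lia.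
by congr (coin (_, _) w); lia.
Qed.

End CoinLaw.

Lemma height_count h a k : height h ->
  (count (occ h) [seq a + z%:Z | z <- iota 0 k])%:Z = h (a - 1) - h (a - 1 + k%:Z).
Proof.
move=> hh; elim: k => [|k IH]; first by rewrite addr0 subrr.
rewrite -addn1 iotaD map_cat count_cat PoszD IH /= /occ addn0 add0n.
have := hh (a + k%:Z).
have -> : a - 1 + (k + 1)%:Z = a + k%:Z by lia.
have -> : a - 1 + k%:Z = a + k%:Z - 1 by lia.
by case: eqP; lia.
Qed.

Lemma num_particles_height (R : realType) (a b : R) h : height h -> a <= b ->
  (num_particles (occ h) a b)%:Z = h (Num.ceil a - 1) - h (Num.floor b).
Proof.
move=> hh ab; have /andP[a1 a2] := ceil_itv a; have /andP[b1 b2] := floor_itv b.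
set c := Num.ceil a in a1 a2 *; set e := Num.floor b in b1 b2 *.
(* The interval may contain no integer; then [e = c - 1] and both sides vanish. *)
have ce : c - 1 <= e.
  have : c - 1 < e + 1 by rewrite -(ltr_int R); lra.
  by lia.
pose k := `|(e - (c - 1))%R|%N.
have -> : e = c - 1 + k%:Z by rewrite /k; lia.
rewrite -height_count//; congr Posz; rewrite /num_particles.
pose s := [seq i <- [seq c + z%:Z | z <- iota 0 k] | occ h i].
have -> : [set i : int | a <= i%:~R <= b /\ occ h i] = [set` [fset i in s]%fset].
  apply/seteqP; split=> i /=.
    case=> /andP[ai ib] hi; rewrite !inE mem_filter hi /=.
    have ci : c <= i by rewrite ceil_le_int.
    have ie : i <= e by rewrite floor_ge_int.
    by apply/mapP; exists `|(i - c)%R|%N; rewrite ?mem_iota /k; lia.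
  rewrite !inE mem_filter => /andP[hi /mapP[z]]; rewrite mem_iota => zk iE.
  split=> //; rewrite -ceil_le_int -floor_ge_int -/c -/e iE.
  by move: zk; rewrite /k; lia.
rewrite set_fsetK card_fseq undup_id ?size_filter//.
rewrite filter_uniq// map_inj_uniq ?iota_uniq// => z z' /addrI.
by case.
Qed.

(** * Transfer to the probability space of the coins *)

Section HeightLaw.
Variables (R : realType) (d : measure_display) (T : measurableType d).
Variables (P : probability T R) (coin : nat * int -> {RV P >-> bool}).
Hypothesis coin_fair : forall k, P (coin k @^-1` [set true]) = (1 / 2)%:E.
Hypothesis coin_indep : mutually_independent coin.

Lemma prob_coin_height (u eps delta : R) : 0 < eps -> 0 < delta ->
  exists N, forall n, (N <= n)%N -> forall i : int, `|i%:~R - u * n%:R| <= 1 ->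
  (P [set w | (eps < `|(coin_height coin n w i)%:~R / n%:R - tasep_h u|)%R]
    <= delta%:E)%E.
Proof.
move=> e0 d0; have [N HN] := tosses_cone_cvg u e0 d0.
exists N => n nN i iu.
pose Q s := eps < `|(evol (rows n n s) (cone (- i)) 0)%:~R / n%:R - tasep_h u|.
rewrite (_ : [set w | _] = [set w | Q (outcome coin (keys n i) w)]); last first.
  by apply/seteqP; split=> w /=; rewrite /Q coin_heightE.
rewrite (prob_outcome coin_fair coin_indep Q (uniq_keys n i)) size_keys lee_fin.
by apply: (HN n nN); rewrite intrN addrC distrC.
Qed.

(** The two heights are read off one outcome, the concatenation of two possibly overlapping
    windows. *)
Lemma measurable_coin_heights n i j (Q : int -> int -> bool) :
  measurable [set w | Q (coin_height coin n w i) (coin_height coin n w j)].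
Proof.
pose m := (n * n.*2.+1)%N.
pose Q' s := Q (evol (rows n n (take m s)) (cone (- i)) 0)
               (evol (rows n n (drop m s)) (cone (- j)) 0).
rewrite (_ : [set w | _] = [set w | Q' (outcome coin (keys n i ++ keys n j) w)]).
  exact: measurable_outcome.
have sz w : size (outcome coin (keys n i) w) = m by rewrite size_map size_keys.
apply/seteqP; split=> w /=; rewrite /Q' /outcome map_cat -!/(outcome _ _ _);
  by rewrite -(sz w) take_size_cat// drop_size_cat// -!coin_heightE.
Qed.

End HeightLaw.

Theorem theorem2 (R : realType) (d : measure_display) (T : measurableType d)
    (P : probability T R) (coin : nat * int -> {RV P >-> bool})
    (coin_fair : forall k, P (coin k @^-1` [set true]) = (1 / 2)%:E)
    (coin_indep : mutually_independent coin)
    (alpha beta : R) (le_alpha_beta : alpha <= beta) :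
  cvg_in_probability P
    (fun n w =>
       (num_particles (tasep (fun k => coin k) n w)
          (alpha * n%:R) (beta * n%:R))%:R / n%:R)
    (tasep_h alpha - tasep_h beta).
Proof.
move=> eps e0.
(* Heights count particles strictly to the right of a site, so the left endpoint is the last site
   before the interval. *)
pose i n := Num.ceil (alpha * n%:R) - 1; pose j n := Num.floor (beta * n%:R).
have countE n w : (num_particles (tasep (fun k => coin k) n w)
    (alpha * n%:R) (beta * n%:R))%:R =
    (coin_height coin n w (i n))%:~R - (coin_height coin n w (j n))%:~R :> R.
  rewrite pmulrn tasep_evol num_particles_height ?intrB//.
    exact/height_evol/height_cone.
  by rewrite ler_wpM2r.
pose E n := [set w | (eps < `|((coin_height coin n w (i n))%:~R -
  (coin_height coin n w (j n))%:~R) / n%:R - (tasep_h alpha - tasep_h beta)|)%R].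
have mE n : measurable (E n).
  exact: (measurable_coin_heights coin n (i n) (j n) (fun a b =>
    (eps < `|(a%:~R - b%:~R) / n%:R - (tasep_h alpha - tasep_h beta)|)%R)).
rewrite [X in X @ _ --> _](_ : _ = fun n => P (E n)); last first.
  by apply/funext => n; congr (P _); apply/seteqP; split=> w /=; rewrite countE.
suff E_small delta : 0 < delta ->
    exists N, forall n, (N <= n)%N -> (P (E n) <= delta%:E)%E.
  apply/fine_cvgP; split; first by near=> n; exact: fin_num_measure.
  apply/cvgrPdist_le => delta d0; have [N HN] := E_small _ d0.
  near=> n; rewrite sub0r normrN ger0_norm ?fine_ge0//=.
  rewrite -lee_fin fineK ?fin_num_measure//; apply: HN.
  by near: n; exact: nbhs_infty_ge.
move=> d0; have e2 : 0 < eps / 2 by lra.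
have d2 : 0 < delta / 2 by lra.
have [N1 HN1] := prob_coin_height coin_fair coin_indep alpha e2 d2.
have [N2 HN2] := prob_coin_height coin_fair coin_indep beta e2 d2.
exists (maxn N1 N2) => n; rewrite geq_max => /andP[nN1 nN2].
have /andP[] := ceil_itv (alpha * n%:R); have /andP[] := floor_itv (beta * n%:R).
rewrite intrD intrB => b1 b2 a1 a2.
have Ha := HN1 n nN1 (i n).
have {}Ha := Ha ltac:(rewrite /i intrB ler_norml; apply/andP; split; lra).
have Hb := HN2 n nN2 (j n).
have {}Hb := Hb ltac:(rewrite /j ler_norml; apply/andP; split; lra).
(* Union bound: outside [A] and [B] each rescaled height is within [eps / 2] of its limit, which
   excludes [E n]. *)
pose A := [set w | (eps / 2 < `|(coin_height coin n w (i n))%:~R / n%:R - tasep_h alpha|)%R].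
pose B := [set w | (eps / 2 < `|(coin_height coin n w (j n))%:~R / n%:R - tasep_h beta|)%R].
have mA : measurable A.
  exact: (measurable_coin_heights coin n (i n) (i n)
    (fun a _ => (eps / 2 < `|a%:~R / n%:R - tasep_h alpha|)%R)).
have mB : measurable B.
  exact: (measurable_coin_heights coin n (j n) (j n)
    (fun b _ => (eps / 2 < `|b%:~R / n%:R - tasep_h beta|)%R)).
have -> : delta = delta / 2 + delta / 2 by lra.
rewrite EFinD; apply: le_trans (leeD Ha Hb); rewrite -/A -/B.
apply: le_trans (measureU2 P mA mB); apply: le_measure; rewrite ?inE//.
  exact: measurableU.
move=> w; rewrite /E /= => lt_eps.
apply: contrapT => /not_orP[/negP + /negP]; rewrite /= -!leNgt => leA leB.
move: lt_eps; rewrite ltNge => /negP; apply.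
set a := (coin_height _ _ _ (i n))%:~R in leA *.
set b := (coin_height _ _ _ (j n))%:~R in leB *.
have -> : (a - b) / n%:R - (tasep_h alpha - tasep_h beta) =
  (a / n%:R - tasep_h alpha) - (b / n%:R - tasep_h beta) by ring.
by apply: le_trans (ler_normB _ _) _; lra.
Unshelve. all: by end_near.
Qed.
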